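(* Let $(\Sigma,\partial)$ be a differential field whose field of constants $\mathbf{C}$ is algebraically closed and of characteristic zero. Let $P,Q\in\Sigma[\partial]\setminus\mathbf{C}[\partial]$ be commuting ordinary differential operators, both of positive order, and let $f(\lambda,\mu)$ be the radical (square-free part) of the differential resultant $\partial\mathrm{Res}(P-\lambda,Q-\mu)$. Then: 1. The ideal $(f)$ generated by $f$ in $\mathbf{C}[\lambda,\mu]$ equals $\mathrm{BC}(P,Q)$. 2. The differential ideal $[f]$ generated by $f$ in $\Sigma[\lambda,\mu]$ equals the radical of the elimination ideal $\mathcal{E}(P-\lambda,Q-\mu)$.
   Context: $\Sigma[\partial]$ is the ring of differential operators with coefficients in $\Sigma$ ($\partial a=a\partial+\partial(a)$). $\lambda,\mu$ are algebraic variables over $\Sigma$ with $\partial(\lambda)=\partial(\mu)=0$, so $\Sigma[\lambda,\mu]$ is a differential ring with ring of constants $\mathbf{C}[\lambda,\mu]$. Burchnall–Chaundy ideal: $\mathrm{BC}(P,Q)=\{g\in\mathbf{C}[\lambda,\mu]\mid g(P,Q)=0\}$, the kernel of the ring homomorphism $\mathbf{C}[\lambda,\mu]\to\Sigma[\partial]$, $\lambda\mapsto P$, $\mu\mapsto Q$. Differential resultant: for operators $A,B$ of orders $n,m$ with coefficients in a differential domain $\mathbb{D}$, $\partial\mathrm{Res}(A,B)$ is the determinant of the $(n+m)\times(n+m)$ matrix whose rows are the coefficients, with respect to $\partial^{n+m-1},\dots,\partial,1$, of $\partial^{m-1}A,\dots,\partial A,A,\partial^{n-1}B,\dots,\partial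 B,B$. Here $\mathbb{D}=\Sigma[\lambda,\mu]$. Elimination ideal: $\mathcal{E}(P-\lambda,Q-\mu)=(P-\lambda,Q-\mu)\cap\Sigma[\lambda,\mu]$, where $(P-\lambda,Q-\mu)=\{C(P-\lambda)+D(Q-\mu)\mid C,D\in\Sigma[\lambda,\mu][\partial]\}$ is the left ideal generated in $\Sigma[\lambda,\mu][\partial]$. *)

(* Defs.v *)
From HB Require Import structures.
From mathcomp Require Import all_boot all_order all_algebra.

Set Implicit Arguments.
Unset Strict Implicit.
Unset Printing Implicit Defensive.

Import GRing.Theory.
Local Open Scope ring_scope.

Record derivation (R : nzRingType) := Derivation {
  der :> R -> R;
  derD : {morph der : x y / x + y};
  derM : forall x y, der (x * y) = der x * y + x * der y
}.

Section DerivationTheory.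
Variables (R : nzRingType) (d : derivation R).

Lemma der0 : d 0 = 0.
Proof. by apply: (@addrI _ (d 0)); rewrite -derD !addr0. Qed.

Lemma derN x : d (- x) = - d x.
Proof. by apply: (@addrI _ (d x)); rewrite -derD !subrr der0. Qed.

Lemma derB x y : d (x - y) = d x - d y.
Proof. by rewrite derD derN. Qed.

Lemma der1 : d 1 = 0.
Proof. by apply: (@addrI _ (d 1)); rewrite addr0 -{3}(mulr1 1) derM mulr1 mul1r. Qed.

Lemma der_sum I (r : seq I) (S : pred I) (F : I -> R) :
  d (\sum_(i <- r | S i) F i) = \sum_(i <- r | S i) d (F i).
Proof. exact: (big_morph d (@derD _ d) der0). Qed.

End DerivationTheory.

Definition is_constant (F : fieldType) (d : derivation F) : pred F :=
  fun x => d x == 0.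

Lemma is_constant_divring (F : fieldType) (d : derivation F) :
  divring_closed (is_constant d).
Proof.
split=> [|x y|x y]; rewrite !unfold_in ?der1 //.
  by move=> /eqP dx /eqP dy; rewrite derB dx dy subrr.
move=> /eqP dx /eqP dy; have [->|y0] := eqVneq y 0.
  by rewrite invr0 mulr0 der0.
have : d (y^-1 * y) = 0 by rewrite mulVf // der1.
rewrite !derM dy mulr0 addr0 => /eqP; rewrite mulf_eq0 (negPf y0) orbF => /eqP ->.
by rewrite dx mul0r mulr0 addr0.
Qed.

HB.instance Definition _ (F : fieldType) (d : derivation F) :=
  GRing.isDivringClosed.Build F (is_constant d) (is_constant_divring d).

Record constants (F : fieldType) (d : derivation F) := Constant {
  cval : F;
  cvalP : cval \in is_constant d
}.

Section Constants.
Variables (F : fieldType) (d : derivation F).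

HB.instance Definition _ := [isSub for @cval F d].
HB.instance Definition _ := [Choice of constants d by <:].
HB.instance Definition _ :=
  [SubChoice_isSubIntegralDomain of constants d by <:].
HB.instance Definition _ :=
  [SubIntegralDomain_isSubField of constants d by <:].

End Constants.

Section PolyDerivation.
Variables (R : nzRingType) (d : derivation R).

Definition pder_fun (p : {poly R}) : {poly R} := \poly_(i < size p) d p`_i.

Lemma coef_pder_fun p i : (pder_fun p)`_i = d p`_i.
Proof. by rewrite coef_poly; case: ltnP => // /(nth_default 0) ->; rewrite der0. Qed.

Lemma pder_funD : {morph pder_fun : p q / p + q}.
Proof. by move=> p q; apply/polyP=> i; rewrite !(coefD, coef_pder_fun) derD. Qed.

Lemma pder_funM p q : pder_fun (p * q) = pder_fun p * q + p * pder_fun q.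
Proof.
apply/polyP=> i; rewrite coefD coef_pder_fun !coefM der_sum -big_split.
by apply: eq_bigr => j _; rewrite /= derM !coef_pder_fun.
Qed.

Definition pder : derivation {poly R} := Derivation pder_funD pder_funM.

End PolyDerivation.

(* [DiffOp p] stands for [\sum_i p`_i d^i], coefficients on the left. *)

Record diffop (R : comNzRingType) (d : derivation R) :=
  DiffOp { coefs : {poly R} }.

Section DiffopRing.
Variables (R : comNzRingType) (d : derivation R).
Implicit Types (A B C : diffop d) (p q : {poly R}) (a : R).

HB.instance Definition _ := [isNew for @coefs R d].
HB.instance Definition _ := [Choice of diffop d by <:].

Definition opadd A B : diffop d := DiffOp d (coefs A + coefs B).
Definition opopp A : diffop d := DiffOp d (- coefs A).
Definition opzero : diffop d := DiffOp d 0.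

Fact opaddA : associative opadd.
Proof. by move=> A B C; apply: val_inj; rewrite /= addrA. Qed.
Fact opaddC : commutative opadd.
Proof. by move=> A B; apply: val_inj; rewrite /= addrC. Qed.
Fact opadd0 : left_id opzero opadd.
Proof. by move=> A; apply: val_inj; rewrite /= add0r. Qed.
Fact opaddN : left_inverse opzero opopp opadd.
Proof. by move=> A; apply: val_inj; rewrite /= addNr. Qed.

HB.instance Definition _ :=
  GRing.isZmodule.Build (diffop d) opaddA opaddC opadd0 opaddN.

(* Left multiplication by d: d (b d^j) = b d^(j+1) + d(b) d^j. *)
Definition lmuld p : {poly R} := p * 'X + pder d p.

(* (\sum_i p_i d^i) q = \sum_i p_i (d^i q). *)
Definition skewmul p q : {poly R} :=
  \sum_(i < size p) p`_i *: iter i lmuld q.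

Lemma lmuldD : {morph lmuld : p q / p + q}.
Proof. by move=> p q; rewrite /lmuld mulrDl derD addrACA. Qed.

Lemma lmuld0 : lmuld 0 = 0.
Proof. by rewrite /lmuld mul0r der0 addr0. Qed.

Lemma lmuldZ a p : lmuld (a *: p) = a *: lmuld p + d a *: p.
Proof.
have -> : lmuld (a *: p) = (a *: p) * 'X + (d a *: p + a *: pder d p).
  congr (_ + _); apply/polyP=> i.
  by rewrite coef_pder_fun coefD !coefZ derM coef_pder_fun.
by rewrite /lmuld scalerDr scalerAl addrCA addrC.
Qed.

Lemma lmuldXn i : lmuld 'X^i = 'X^(i.+1).
Proof.
rewrite /lmuld exprSr -[RHS]addr0; congr (_ + _); apply/polyP=> j.
by rewrite coef_pder_fun coefXn coef0; case: eqP; rewrite ?der1 ?der0.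
Qed.

Lemma iter_lmuldD i : {morph iter i lmuld : p q / p + q}.
Proof. by move=> p q; elim: i => //= i ->; rewrite lmuldD. Qed.

Lemma skewmul_wide n p q : (size p <= n)%N ->
  skewmul p q = \sum_(i < n) p`_i *: iter i lmuld q.
Proof.
move=> le_pn; rewrite /skewmul (big_ord_widen _ (fun i => p`_i *: iter i lmuld q) le_pn).
rewrite big_mkcond; apply: eq_bigr => i _.
by case: ltnP => // /(nth_default 0) ->; rewrite scale0r.
Qed.

Lemma skewmulDl : left_distributive skewmul +%R.
Proof.
move=> p q r; pose n := maxn (size p) (size q).
rewrite !(@skewmul_wide n) ?leq_maxl ?leq_maxr ?size_polyD // -big_split.
by apply: eq_bigr => i _; rewrite /= coefD scalerDl.
Qed.

Lemma skewmulDr : right_distributive skewmul +%R.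
Proof.
move=> p q r; rewrite /skewmul -big_split.
by apply: eq_bigr => i _; rewrite /= iter_lmuldD scalerDr.
Qed.

Lemma skewmul0l q : skewmul 0 q = 0.
Proof. by rewrite /skewmul size_poly0 big_ord0. Qed.

Lemma skewmulZl a p q : skewmul (a *: p) q = a *: skewmul p q.
Proof.
rewrite (@skewmul_wide (size p)) ?size_scale_leq // scaler_sumr.
by apply: eq_bigr => i _; rewrite coefZ scalerA.
Qed.

Lemma skewmulXn i q : skewmul 'X^i q = iter i lmuld q.
Proof.
rewrite /skewmul size_polyXn big_ord_recr /= coefXn eqxx scale1r big1 ?add0r //.
by move=> j _; rewrite coefXn ltn_eqF // scale0r.
Qed.

Lemma skewmul_suml I (r : seq I) (F : I -> {poly R}) q :
  skewmul (\sum_(i <- r) F i) q = \sum_(i <- r) skewmul (F i) q.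
Proof. exact: (big_morph (skewmul^~ q) (fun p1 p2 => skewmulDl p1 p2 q) (skewmul0l q)). Qed.

Lemma skewmul_lmuld p q : skewmul (lmuld p) q = lmuld (skewmul p q).
Proof.
have monomial a i : skewmul (lmuld (a *: 'X^i)) q = lmuld (skewmul (a *: 'X^i) q).
  have -> : lmuld (a *: 'X^i) = a *: 'X^(i.+1) + d a *: 'X^i.
    by rewrite lmuldZ lmuldXn.
  by rewrite skewmulDl !skewmulZl !skewmulXn lmuldZ.
rewrite -[p]coefK poly_def (big_morph lmuld lmuldD lmuld0) !skewmul_suml.
by rewrite (big_morph lmuld lmuldD lmuld0); apply: eq_bigr => i _; apply: monomial.
Qed.

Lemma skewmulA : associative skewmul.
Proof.
move=> p q r; rewrite {2}/skewmul skewmul_suml; apply: eq_bigr => i _.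
rewrite skewmulZl; congr (_ *: _).
by elim: (nat_of_ord i) => //= j ->; rewrite skewmul_lmuld.
Qed.

Lemma skewmul1l : left_id 1 skewmul.
Proof. by move=> q; rewrite -(expr0 'X) skewmulXn. Qed.

Lemma skewmulCl a q : skewmul a%:P q = a *: q.
Proof. by rewrite -[a%:P]mulr1 mul_polyC skewmulZl skewmul1l. Qed.

Lemma skewmul1r : right_id 1 skewmul.
Proof.
move=> p; rewrite -[RHS]coefK poly_def; apply: eq_bigr => i _; congr (_ *: _).
by elim: (nat_of_ord i) => //= j ->; rewrite lmuldXn.
Qed.

Definition opmul A B : diffop d := DiffOp d (skewmul (coefs A) (coefs B)).
Definition opone : diffop d := DiffOp d 1.

Fact opmulA : associative opmul.
Proof. by move=> A B C; apply: val_inj; rewrite /= skewmulA. Qed.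
Fact opmul1l : left_id opone opmul.
Proof. by move=> A; apply: val_inj; rewrite /= skewmul1l. Qed.
Fact opmul1r : right_id opone opmul.
Proof. by move=> A; apply: val_inj; rewrite /= skewmul1r. Qed.
Fact opmulDl : left_distributive opmul +%R.
Proof. by move=> A B C; apply: val_inj; rewrite /= skewmulDl. Qed.
Fact opmulDr : right_distributive opmul +%R.
Proof. by move=> A B C; apply: val_inj; rewrite /= skewmulDr. Qed.
Fact opone_neq0 : opone != 0.
Proof. by apply/eqP=> /(congr1 (@coefs _ _)) /eqP; rewrite /= oner_eq0. Qed.

HB.instance Definition _ := GRing.Zmodule_isNzRing.Build (diffop d)
  opmulA opmul1l opmul1r opmulDl opmulDr opone_neq0.

Definition opC a : diffop d := DiffOp d a%:P.
Definition opD : diffop d := DiffOp d 'X.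
Definition op_order A : nat := (size (coefs A)).-1.

Lemma opD_opC a : opD * opC a = opC a * opD + opC (d a).
Proof.
apply: val_inj; change (skewmul 'X a%:P = skewmul a%:P 'X + (d a)%:P).
rewrite -['X in LHS]expr1 skewmulXn /= /lmuld skewmulCl mul_polyC; congr (_ + _).
by apply/polyP=> i; rewrite coef_pder_fun !coefC; case: eqP; rewrite ?der0.
Qed.

Lemma coefs_sum A : A = \sum_(i < size (coefs A)) opC (coefs A)`_i * opD ^+ i.
Proof.
have opCM a B : coefs (opC a * B) = a *: coefs B.
  exact: skewmulCl.
have opDX i : coefs (opD ^+ i) = 'X^i.
  elim: i => // i IHi; rewrite exprS.
  change (skewmul 'X (coefs (opD ^+ i)) = 'X^(i.+1)).
  by rewrite IHi -['X in LHS]expr1 skewmulXn /= lmuldXn.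
apply: val_inj; rewrite /= (big_morph (@coefs R d) (id1 := 0) (op1 := +%R)) //.
by rewrite -[LHS]coefK poly_def; apply: eq_bigr => i _; rewrite opCM opDX.
Qed.

(* The differential (Sylvester) resultant; rows d^(m-1) A, .., A, d^(n-1) B, .., B
   and columns d^(n+m-1), .., 1, where n and m are the orders of A and B. *)
Definition dres A B : R :=
  let n := op_order A in let m := op_order B in
  \det (\matrix_(i < n + m, j < n + m)
          (coefs (if (i < m)%N then opD ^+ (m - i.+1) * A
                  else opD ^+ (n + m - i.+1) * B))`_(n + m - j.+1)).

End DiffopRing.

Definition has_constant_coefs (F : fieldType) (d : derivation F)
    (A : diffop d) : Prop :=
  forall i, (coefs A)`_i \in is_constant d.

(* The inner variable is lambda, the outer one is mu. *)

Notation bipoly R := {poly {poly R}}.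

Definition bder (R : nzRingType) (d : derivation R) : derivation (bipoly R) :=
  pder (pder d).

Definition lambda (R : nzRingType) : bipoly R := 'X%:P.
Definition mu (R : nzRingType) : bipoly R := 'X.

Lemma pderX (R : nzRingType) (d : derivation R) : pder d 'X = 0.
Proof.
apply/polyP=> i; rewrite coef_pder_fun coefX coef0.
by case: (i == 1%N); [exact: der1 | exact: der0].
Qed.

Lemma pderC (R : nzRingType) (d : derivation R) (c : R) :
  pder d c%:P = (d c)%:P.
Proof.
apply/polyP=> i; rewrite coef_pder_fun !coefC.
by case: (i == 0%N); rewrite ?der0.
Qed.

Lemma bder_lambda (R : nzRingType) (d : derivation R) : bder d (lambda R) = 0.
Proof. by rewrite /bder /lambda pderC pderX. Qed.

Lemma bder_mu (R : nzRingType) (d : derivation R) : bder d (mu R) = 0.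
Proof. exact: pderX. Qed.

Definition opshift (R : comNzRingType) (d : derivation R) (A : diffop d)
    (c : bipoly R) : diffop (bder d) :=
  DiffOp (bder d) (map_poly (fun a => a%:P%:P) (coefs A)) - opC (bder d) c.

Definition const_embed (F : fieldType) (d : derivation F)
    (f : bipoly (constants d)) : bipoly F :=
  map_poly (map_poly (@cval F d)) f.

Definition op_eval (F : fieldType) (d : derivation F)
    (g : bipoly (constants d)) (P Q : diffop d) : diffop d :=
  \sum_(j < size g) \sum_(i < size g`_j)
    opC d (cval g`_j`_i) * P ^+ i * Q ^+ j.

Definition BC_ideal (F : fieldType) (d : derivation F) (P Q : diffop d)
    (g : bipoly (constants d)) : Prop :=
  op_eval g P Q = 0.

Definition gen_ideal (R : comNzRingType) (f g : R) : Prop :=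
  exists h, g = h * f.

Definition diff_ideal (R : comNzRingType) (d : derivation R)
    (I : R -> Prop) : Prop :=
  [/\ I 0, forall x y, I x -> I y -> I (x + y),
      forall a x, I x -> I (a * x) & forall x, I x -> I (d x)].

Definition gen_diff_ideal (R : comNzRingType) (d : derivation R)
    (f g : R) : Prop :=
  forall I, diff_ideal d I -> I f -> I g.

Definition elimination_ideal (R : comNzRingType) (d : derivation R)
    (A B : diffop d) (g : R) : Prop :=
  exists C D : diffop d, opC d g = C * A + D * B.

Definition radical_ideal (R : comNzRingType) (I : R -> Prop) (g : R) : Prop :=
  exists k, I (g ^+ k.+1).

Definition irreducible (R : idomainType) (p : R) : Prop :=
  [/\ p != 0, p \isn't a GRing.unit &
      forall a b, p = a * b -> a \is a GRing.unit \/ b \is a GRing.unit].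

Definition associate (R : idomainType) (p q : R) : Prop :=
  exists2 u, u \is a GRing.unit & p = u * q.

(* [f] is, up to a unit, the product of the distinct irreducible factors of
   [h]. Over F[lambda, mu] the units are the nonzero elements of F; this
   matters because a resultant of non-monic operators may carry a non-constant
   factor from F. *)
Definition squarefree_part (R : idomainType) (h f : R) : Prop :=
  exists (n : nat) (p : 'I_n -> R) (e : 'I_n -> nat),
    [/\ forall i, irreducible (p i),
        forall i j, associate (p i) (p j) -> i = j,
        associate h (\prod_(i < n) p i ^+ (e i).+1) &
        associate f (\prod_(i < n) p i)].

(* Main.v *)
Require Import Defs.
From HB Require Import structures.
From mathcomp Require Import all_boot all_order all_algebra.
From Stdlib Require Import Classical.

(** Write [R = Sigma[lambda, mu]], [A = P - lambda], [B = Q - mu], and let [ev]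
    send [g] in [R] to the operator [g(P, Q)], the sum of the [g_ij P^i Q^j]
    with the coefficients kept on the left. As [lambda] and [mu] are central
    and [P], [Q] commute, working modulo the left ideal [(A, B)] amounts to
    replacing [lambda] by [P] and [mu] by [Q] on the right of an operator; so
    the elimination ideal is exactly the kernel of [ev] ([elimination_evP]).
    On [C[lambda, mu]] the map [ev] is the ring morphism that defines
    [BC(P, Q)]; on [R] it is only [Sigma]-linear.

    The link between [C] and [Sigma] is a fact on commutants: if two operators
    of the same order commute with [P], the quotient of their leading
    coefficients is a constant ([commutant_lead]). A combination over [Sigma]
    of polynomials in [P] and [Q] can therefore be rewritten, one order at a
    time, until its terms have distinct orders. Two consequences: the kernel of
    [ev] is spanned over [Sigma] by [BC(P, Q)] ([ev_eq0_const_span]), and it is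
    a prime ideal of [R], because leading terms multiply ([ev_prime]).

    Counting dimensions shows that the kernel is nonzero ([ev_kernel_neq0]), so
    [BC(P, Q)] is a nonzero prime ideal; it meets [C[lambda]] in [0] since the
    powers of [P] have distinct orders. By the lemma of Gauss it is generated
    by one element [f0] ([prime_ideal_principal]). By the preceding paragraph
    [f0] also generates the kernel of [ev], and is a prime element of [R].

    Let [h] be the differential resultant, and [n], [m] the orders of [A], [B].
    The adjugate of the Sylvester matrix [S] shows that [h] lies in [(A, B)],
    hence that [f0] divides [h]. Conversely, [f0] has constant coefficients, so
    it is central among the operators and the left ideal contains [X f0 = f0 X]
    for every operator [X]. Dividing cofactors by [A], whose leading
    coefficient is a unit, one writes each [f0 d^r] with [r < n + m] as a
    combination of the rows of [S]; thus [W S = f0 I] for some matrix [W], and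
    [h] divides [f0^(n + m)] ([dres_dvd_exp]). As [f0] is prime, [h] is a unit
    times [f0^k] with [k > 0]: up to units, [f0] is the only square-free part
    of [h]. Finally, the ideal generated by [f0] in [R] is differential, since
    [f0] is a constant, and it is radical, since [f0] is prime. *)

Set Implicit Arguments.
Unset Strict Implicit.
Unset Printing Implicit Defensive.

Import GRing.Theory.
Local Open Scope ring_scope.

(** * Leading coefficients of products of operators *)

Section LeadingCoefficients.
Variables (R : comNzRingType) (d : derivation R).
Implicit Types (p q : {poly R}) (A B C : diffop d).

Lemma size_lmuld q k : (size q <= k)%N -> (size (lmuld d q) <= k.+1)%N.
Proof.
move=> le_qk; rewrite (leq_trans (size_polyD _ _)) // geq_max.
rewrite (leq_trans (size_polyMleq _ _)) ?size_polyX ?addn2 //=.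
by rewrite (leq_trans (size_poly _ _)) // leqW.
Qed.

Lemma size_iter_lmuld i q k :
  (size q <= k)%N -> (size (iter i (lmuld d) q) <= i + k)%N.
Proof. by move=> le_qk; elim: i => //= i IHi; apply: size_lmuld. Qed.

Lemma coef_iter_lmuld i q k : (size q <= k.+1)%N ->
  (iter i (lmuld d) q)`_(i + k) = q`_k.
Proof.
move=> le_qk; elim: i => //= i IHi; rewrite addSn coefD coefMX /= IHi.
rewrite coef_pder_fun [X in d X]nth_default ?der0 ?addr0 //.
by rewrite -addnS size_iter_lmuld.
Qed.

(** The subleading coefficient, from [d^i b = b d^i + i b' d^(i-1) + ...].
    Multiplying by ['X] shifts indices by one, so that the statement also makes
    sense when [i + k = 0], where the coefficient of index [-1] reads as [0]. *)
Lemma coef_iter_lmuldX i q k : (size q <= k.+1)%N ->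
  (iter i (lmuld d) q * 'X)`_(i + k) = (q * 'X)`_k + d q`_k *+ i.
Proof.
move=> le_qk; elim: i => [|i IHi]; first by rewrite addr0.
rewrite /= addSn coefMX /= coefD coef_pder_fun IHi coef_iter_lmuld //.
by rewrite -addrA -mulrSr.
Qed.

Lemma size_skewmul p q n k : (size p <= n.+1)%N -> (size q <= k)%N ->
  (size (skewmul d p q) <= n + k)%N.
Proof.
move=> le_pn le_qk; rewrite (skewmul_wide _ _ le_pn).
apply: (big_ind (fun r : {poly R} => (size r <= n + k)%N)).
- by rewrite size_poly0.
- by move=> r s le_r le_s; rewrite (leq_trans (size_polyD _ _)) // geq_max le_r.
move=> i _; rewrite (leq_trans (size_scale_leq _ _)) //.
by rewrite (leq_trans (size_iter_lmuld _ le_qk)) // leq_add2r -ltnS.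
Qed.

Lemma coef_skewmul p q n k : (size p <= n.+1)%N -> (size q <= k.+1)%N ->
  (skewmul d p q)`_(n + k) = p`_n * q`_k.
Proof.
move=> le_pn le_qk; rewrite (skewmul_wide _ _ le_pn) coef_sum big_ord_recr /=.
rewrite coefZ coef_iter_lmuld // big1 ?add0r // => i _.
rewrite coefZ [X in _ * X]nth_default ?mulr0 //.
by rewrite (leq_trans (size_iter_lmuld _ le_qk)) // addnS ltn_add2r.
Qed.

(** The three ways to reach order [n + k - 1]: lower the right factor, let one
    of the [n] derivations act on its leading coefficient, or lower the left
    factor. Only the middle one sees the derivation, which is what makes
    commutation informative. *)
Lemma coef_skewmulX p q n k : (size p <= n.+1)%N -> (size q <= k.+1)%N ->
  (skewmul d p q * 'X)`_(n + k) =
    p`_n * (q * 'X)`_k + (p`_n * d q`_k) *+ n + (p * 'X)`_n * q`_k.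
Proof.
move=> le_pn le_qk; rewrite (skewmul_wide _ _ le_pn) mulr_suml coef_sum.
rewrite big_ord_recr /= -scalerAl coefZ coef_iter_lmuldX //.
rewrite mulrDr mulrnAr [in RHS]addrC; congr (_ + _).
case: n le_pn => [|n] le_pn; first by rewrite big_ord0 coefMX mul0r.
rewrite big_ord_recr /= big1 ?add0r => [|i _].
  by rewrite -scalerAl coefZ !coefMX /= coef_iter_lmuld.
rewrite -scalerAl coefZ coefMX /= [X in _ * X]nth_default ?mulr0 //.
by rewrite (leq_trans (size_iter_lmuld _ le_qk)) // addnS ltn_add2r.
Qed.

Lemma opC_is_additive : additive (opC d).
Proof. by move=> a b; apply: val_inj; rewrite /= polyCB. Qed.

Lemma opC_is_monoid_morphism : monoid_morphism (opC d).
Proof.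
split=> // a b; apply: val_inj; change ((a * b)%:P = skewmul d a%:P b%:P).
by rewrite skewmulCl -mul_polyC -polyCM.
Qed.
HB.instance Definition _ :=
  GRing.isAdditive.Build R (diffop d) (opC d) opC_is_additive.
HB.instance Definition _ :=
  GRing.isMonoidMorphism.Build R (diffop d) (opC d) opC_is_monoid_morphism.

Lemma coefs_is_additive : additive (@coefs R d).
Proof. by []. Qed.
HB.instance Definition _ :=
  GRing.isAdditive.Build (diffop d) {poly R} (@coefs R d) coefs_is_additive.

Lemma coefs_big I (r : seq I) (S : pred I) (G : I -> diffop d) :
  coefs (\sum_(i <- r | S i) G i) = \sum_(i <- r | S i) coefs (G i).
Proof. exact: (raddf_sum (@coefs R d)). Qed.

Lemma coefsB A B : coefs (A - B) = coefs A - coefs B.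
Proof. by []. Qed.

Lemma coefsM A B : coefs (A * B) = skewmul d (coefs A) (coefs B).
Proof. by []. Qed.

Lemma coefs_opCM a A : coefs (opC d a * A) = a *: coefs A.
Proof. exact: skewmulCl. Qed.

Lemma coefs_opDX i : coefs (opD d ^+ i) = 'X^i.
Proof.
elim: i => // i IHi; rewrite exprS coefsM IHi.
by change (skewmul d 'X 'X^i = 'X^(i.+1)); rewrite -['X in LHS]expr1 skewmulXn /= lmuldXn.
Qed.

Lemma size_coefs A : A != 0 -> size (coefs A) = (op_order A).+1.
Proof. by move=> A0; rewrite /op_order prednK // lt0n size_poly_eq0. Qed.

Lemma opC_comm a A : d a = 0 -> GRing.comm (opC d a) A.
Proof.
move=> da0; have aD : GRing.comm (opC d a) (opD d).
  by rewrite /GRing.comm opD_opC da0 raddf0 addr0.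
rewrite [A]coefs_sum; apply: commr_sum => i _; apply: commrM.
  by rewrite /GRing.comm -!rmorphM mulrC.
exact: commrX.
Qed.

End LeadingCoefficients.

Section SkewDomain.
Variables (R : idomainType) (d : derivation R).
Implicit Types (A B : diffop d).

Lemma size_opM A B : A != 0 -> B != 0 ->
  size (coefs (A * B)) = (size (coefs A) + size (coefs B)).-1.
Proof.
move=> A0 B0.
have [leA leB] := (eq_leq (size_coefs A0), eq_leq (size_coefs B0)).
apply/eqP; rewrite (size_coefs A0) (size_coefs B0) addSn /= eqn_leq size_skewmul // addnS.
rewrite ltnNge; apply/negP=> /leq_sizeP/(_ _ (leqnn _))/eqP.
rewrite coef_skewmul // mulf_eq0 !lead_coef_eq0.
by rewrite (negPf (A0 : coefs A != 0)) (negPf (B0 : coefs B != 0)).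
Qed.

Lemma opM_eq0 A B : A * B = 0 -> A = 0 \/ B = 0.
Proof.
have [->|A0] := eqVneq A 0; first by left.
have [->|B0] := eqVneq B 0; first by right.
move=> AB0; have := size_opM A0 B0; rewrite AB0 size_poly0.
have : (0 < size (coefs A))%N by rewrite lt0n size_poly_eq0.
have : (0 < size (coefs B))%N by rewrite lt0n size_poly_eq0.
by case: (size _) => // a _; case: (size _) => // b _; rewrite addSn addnS.
Qed.

End SkewDomain.

(** * The differential resultant and the left ideal of two operators *)

Section LeftIdeal.
Variables (R : comNzRingType) (d : derivation R) (A B : diffop d).
Implicit Types X Y : diffop d.

Definition in_left_ideal X := exists C D, X = C * A + D * B.

Lemma in_left_ideal0 : in_left_ideal 0.
Proof. by exists 0, 0; rewrite !mul0r addr0. Qed.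

Lemma in_left_idealD X Y :
  in_left_ideal X -> in_left_ideal Y -> in_left_ideal (X + Y).
Proof.
move=> [C [D ->]] [C' [D' ->]]; exists (C + C'), (D + D').
by rewrite !mulrDl addrACA.
Qed.

Lemma in_left_ideal_lmul Y X : in_left_ideal X -> in_left_ideal (Y * X).
Proof.
by move=> [C [D ->]]; exists (Y * C), (Y * D); rewrite mulrDr !mulrA.
Qed.

Lemma in_left_ideal_l Y : in_left_ideal (Y * A).
Proof. by exists Y, 0; rewrite mul0r addr0. Qed.

Lemma in_left_ideal_r Y : in_left_ideal (Y * B).
Proof. by exists 0, Y; rewrite mul0r add0r. Qed.

End LeftIdeal.

Section Resultant.
Variables (R : idomainType) (d : derivation R) (A B : diffop d).
Local Notation n := (op_order A).
Local Notation m := (op_order B).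
Hypothesis A_order : (0 < n)%N.

Definition sylvester_row (i : nat) : diffop d :=
  if (i < m)%N then opD d ^+ (m - i.+1) * A else opD d ^+ (n + m - i.+1) * B.

Definition sylvester : 'M[R]_(n + m) :=
  \matrix_(i < n + m, j < n + m) (coefs (sylvester_row i))`_(n + m - j.+1).

Lemma dresE : dres A B = \det sylvester.
Proof. by []. Qed.

Lemma size_sylvester_row i : (i < n + m)%N ->
  (size (coefs (sylvester_row i)) <= n + m)%N.
Proof.
move=> lt_i; rewrite /sylvester_row; case: ltnP => [lt_im|le_mi].
  apply: leq_trans (size_skewmul _ (eq_leq _) (leqSpred _)) _.
    by rewrite coefs_opDX size_polyXn.
  by rewrite -/n addnS -addSn subnSK // addnC leq_add2l leq_subr.
apply: leq_trans (size_skewmul _ (eq_leq _) (leqSpred _)) _.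
  by rewrite coefs_opDX size_polyXn.
rewrite -/m addnS -addSn subnSK // -[X in (_ <= X)%N](subnK (ltnW lt_i)).
by rewrite leq_add2l.
Qed.

Definition sylvester_comb (w : nat -> R) : diffop d :=
  \sum_(i < n + m) opC d (w i) * sylvester_row i.

Lemma size_sylvester_comb w : (size (coefs (sylvester_comb w)) <= n + m)%N.
Proof.
rewrite coefs_big; apply: (big_ind (fun r : {poly R} => (size r <= n + m)%N)).
- by rewrite size_poly0.
- by move=> r s le_r le_s; rewrite (leq_trans (size_polyD _ _)) // geq_max le_r.
move=> i _; rewrite coefs_opCM (leq_trans (size_scale_leq _ _)) //.
exact: size_sylvester_row.
Qed.

Lemma coef_sylvester_comb w (j : 'I_(n + m)) :
  (coefs (sylvester_comb w))`_(n + m - j.+1) = ((\row_i w i) *m sylvester) 0 j.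
Proof.
rewrite coefs_big coef_sum mxE; apply: eq_bigr => i _.
by rewrite coefs_opCM coefZ !mxE.
Qed.

Lemma sylvester_comb_in_left_ideal w : in_left_ideal A B (sylvester_comb w).
Proof.
apply: (big_ind (in_left_ideal A B)) => [|X Y|i _].
- exact: in_left_ideal0.
- exact: in_left_idealD.
rewrite /sylvester_row; case: ltnP => _; rewrite mulrA.
  exact: in_left_ideal_l.
exact: in_left_ideal_r.
Qed.

(** The last row of [adj S * S = det S * I] says that the combination of the
    rows of [S] by cofactors has the resultant as its coefficient of [d^0] and
    zero elsewhere. *)
Lemma dres_in_left_ideal : in_left_ideal A B (opC d (dres A B)).
Proof.
have nm_gt0 : (0 < n + m)%N by rewrite addn_gt0 A_order.
have lt_last : ((n + m).-1 < n + m)%N by rewrite prednK.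
pose i0 := Ordinal lt_last.
pose w (i : nat) := if insub i is Some i' then (\adj sylvester) i0 i' else 0.
suff -> : opC d (dres A B) = sylvester_comb w by apply: sylvester_comb_in_left_ideal.
apply: val_inj; apply/polyP=> k /=.
have [lt_k|le_k] := ltnP k (n + m); last first.
  rewrite !nth_default // ?(leq_trans (size_sylvester_comb _)) //.
  by rewrite (leq_trans (size_polyC_leq1 _)) // (leq_trans nm_gt0).
have lt_k' : (n + m - k.+1 < n + m)%N by rewrite ltn_subrL.
have -> : k = (n + m - (Ordinal lt_k').+1)%N by rewrite /= subnSK // subKn // ltnW.
rewrite coef_sylvester_comb.
have -> : \row_(i < n + m) w i = row i0 (\adj sylvester).
  by apply/rowP=> i; rewrite [LHS]mxE [RHS]mxE /w valK.
rewrite -row_mul mul_adj_mx !mxE /= coefC subnSK // subKn ?(ltnW lt_k) //.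
rewrite dresE -val_eqE /=; case: k lt_k {lt_k'} => [|k] lt_k.
  by rewrite subn1 eqxx.
by rewrite -subn1 [(n + m - 1)%N == _]gtn_eqF // ltn_sub2l // (leq_ltn_trans _ lt_k).
Qed.

Lemma right_division (X : diffop d) : lead_coef (coefs A) \is a GRing.unit ->
  exists Y X1, X = Y * A + X1 /\ (size (coefs X1) <= n)%N.
Proof.
move=> uA; have [k] := ubnP (size (coefs X)).
elim: k X => // k IHk X /ltnSE le_k.
have [le_n|lt_n] := leqP (size (coefs X)) n.
  by exists 0, X; rewrite mul0r add0r.
pose l := (size (coefs X)).-1.
have szX : size (coefs X) = l.+1 by rewrite prednK // (leq_ltn_trans _ lt_n).
have le_nl : (n <= l)%N by rewrite -ltnS -szX.
pose T := opC d ((coefs X)`_l / lead_coef (coefs A)) * opD d ^+ (l - n).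
have szTA : (size (coefs (T * A)%R) <= l.+1)%N.
  rewrite -mulrA coefs_opCM (leq_trans (size_scale_leq _ _)) //.
  apply: leq_trans (size_skewmul _ (eq_leq _) (leqSpred _)) _.
    by rewrite coefs_opDX size_polyXn.
  by rewrite addnS subnK.
have TAl : (coefs (T * A)%R)`_l = (coefs X)`_l.
  have lead_row : (coefs (opD d ^+ (l - n) * A)%R)`_l = lead_coef (coefs A).
    have := coef_skewmul d (eq_leq (size_polyXn R (l - n))) (leqSpred (size (coefs A))).
    rewrite -/n subnK // coefXn eqxx mul1r -(coefs_opDX d).
    by rewrite -lead_coefE => ->.
  by rewrite -mulrA coefs_opCM coefZ lead_row divrK.
have [|Y [X1 [XE szX1]]] := IHk (X - T * A).
  apply: (leq_trans _ le_k); rewrite szX ltnS; apply/leq_sizeP => j.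
  rewrite coefsB coefB leq_eqVlt => /orP[/eqP<-|lt_lj]; first by rewrite TAl subrr.
  by rewrite !nth_default ?subrr ?szX // (leq_trans szTA).
by exists (Y + T), X1; split=> //; rewrite mulrDl addrAC -XE subrK.
Qed.

(** Conversely, the orders below [m] and [n] are exactly those that make the
    powers of [d] in [C] and [D] label rows of the Sylvester matrix. *)
Lemma sylvester_combE C D : (size (coefs C) <= m)%N -> (size (coefs D) <= n)%N ->
  C * A + D * B =
  sylvester_comb (fun i => if (i < m)%N then (coefs C)`_(m - i.+1)
                 else (coefs D)`_(n + m - i.+1)).
Proof.
have wide k (X : diffop d) : (size (coefs X) <= k)%N ->
    X = \sum_(0 <= i < k) opC d (coefs X)`_i * opD d ^+ i.
  move=> le_k; rewrite big_mkord [LHS]coefs_sum.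
  rewrite (big_ord_widen _ (fun i => opC d (coefs X)`_i * opD d ^+ i) le_k).
  rewrite big_mkcond; apply: eq_bigr => i _; case: ltnP => // le_i.
  by rewrite nth_default // raddf0 mul0r.
move=> /wide CE /wide DE.
rewrite /sylvester_comb -(big_mkord xpredT (fun i => opC d (if (i < m)%N then
    (coefs C)`_(m - i.+1) else (coefs D)`_(n + m - i.+1)) * sylvester_row i)).
rewrite (big_cat_nat (leq0n m) (leq_addl _ _)) /=; congr (_ + _).
  rewrite {1}CE mulr_suml big_nat_rev add0n; apply: eq_big_nat => i /andP[_ lt_im].
  by rewrite /sylvester_row lt_im mulrA.
rewrite -{1}[m]add0n big_addn addnK {1}DE mulr_suml big_nat_rev add0n.
apply: eq_big_nat => i /andP[_ lt_in].
by rewrite /sylvester_row ltnNge leq_addl /= -addSn subnDr mulrA.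
Qed.

(** The hypothesis puts each [f d^r] with [r < n + m] in the left ideal. Its
    cofactors can be chosen of orders below [m] and [n]: with [D = Y A + D1],
    [C A + D B = (C + Y B) A + D1 B] because [A] and [B] commute, and then the
    order of [C + Y B] is forced. So all rows of [f I] are combinations of rows
    of the Sylvester matrix; take determinants. *)
Lemma dres_dvd_exp f : lead_coef (coefs A) \is a GRing.unit -> A * B = B * A ->
    (forall X, in_left_ideal A B (opC d f * X)) ->
  exists w, w * dres A B = f ^+ (n + m).
Proof.
move=> uA AB fX.
have rowP (r : 'I_(n + m)) : exists w : 'rV_(n + m), w *m sylvester = row r f%:M.
  (* The columns list the powers of the derivation in decreasing order, so
     that index [r] stands for the power [n + m - r - 1]. *)
  have [C [D fE]] := fX (opD d ^+ (n + m - r.+1)).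
  have [Y [D1 [DE szD1]]] := right_division D uA.
  pose C1 := C + Y * B.
  have fE1 : opC d f * opD d ^+ (n + m - r.+1) = C1 * A + D1 * B.
    by rewrite fE DE !mulrDl -!mulrA AB addrA.
  have A0 : A != 0 by apply: contraTneq A_order => ->; rewrite /op_order size_poly0.
  have szC1 : (size (coefs C1) <= m)%N.
    have [->|C1_0] := eqVneq C1 0; first by rewrite size_poly0.
    have : (size (coefs (C1 * A)%R) <= n + m)%N.
      have -> : C1 * A = opC d f * opD d ^+ (n + m - r.+1) - D1 * B by rewrite fE1 addrK.
      rewrite coefsB (leq_trans (size_polyD _ _)) // size_polyN geq_max; apply/andP; split.
        rewrite coefs_opCM (leq_trans (size_scale_leq _ _)) // coefs_opDX.
        by rewrite size_polyXn subnSK // leq_subr.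
      apply: leq_trans (@size_skewmul _ _ _ _ n.-1 m.+1 _ (leqSpred _)) _.
        by rewrite prednK.
      by rewrite addnS -addSn prednK.
    rewrite size_opM // (size_coefs A0) addnS /= addnC leq_add2l //.
  have := sylvester_combE szC1 szD1; rewrite -fE1; set w := (fun i => _) => wE.
  exists (\row_i w i); apply/rowP => j; rewrite -coef_sylvester_comb -wE coefs_opCM.
  rewrite coefs_opDX coefZ coefXn !mxE mulr_natr; congr (_ *+ nat_of_bool _).
  by rewrite eqn_sub2lE // eqSS eq_sym.
have [W WE] := fin_all_exists rowP.
pose M := \matrix_i W i.
exists (\det M).
rewrite dresE -det_mulmx.
have -> : M *m sylvester = f%:M.
  by apply/row_matrixP=> r; rewrite row_mul rowK WE.
by rewrite det_scalar.
Qed.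

End Resultant.

(** * Principal prime ideals in two variables *)

Lemma ex_minimizer (T : Type) (S : T -> Prop) (m : T -> nat) :
  (exists x, S x) -> exists2 x, S x & forall y, S y -> (m x <= m y)%N.
Proof.
move=> [x Sx]; apply: NNPP => no_min.
suff noS k y : S y -> (k <= m y)%N by have := noS (m x).+1 x Sx; rewrite ltnn.
elim: k y => // k IHk y Sy; rewrite ltn_neqAle IHk // andbT.
by apply/eqP => k_my; apply: no_min; exists y => // z /IHk; rewrite k_my.
Qed.

Lemma closed_field_root (K : fieldType) (p : {poly K}) :
  GRing.closed_field_axiom K -> (1 < size p)%N -> exists x, root p x.
Proof.
move=> closedK p_gt1; pose n := (size p).-1.
have n_gt0 : (0 < n)%N by rewrite -ltnS prednK // ltnW.
have [x xn] := closedK n (fun i => - p`_i / lead_coef p) n_gt0.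
exists x; apply/rootP; rewrite (@horner_coef_wide _ n.+1) ?leqSpred //.
rewrite big_ord_recr /= xn -lead_coefE mulr_sumr -big_split big1 // => i _.
by rewrite /= mulrA mulrCA divff ?mulr1 ?mulNr ?subrr // lead_coef_eq0 -size_poly_gt0 ltnW.
Qed.

Section Gauss.
Variable K : fieldType.
Hypothesis closedK : GRing.closed_field_axiom K.
Implicit Types (f g q : {poly {poly K}}) (c : {poly K}).

(** If every coefficient of [q] vanishes at [a], [q] is divisible by the prime
    ['X - a] of the coefficient ring. *)
Lemma factor_inner_root q a : map_poly (horner_eval a) q = 0 ->
  exists q1, q = q1 * ('X - a%:P)%:P.
Proof.
move=> qa0; exists (map_poly (fun c => c %/ ('X - a%:P)) q); apply/polyP=> j.
rewrite coefMC coef_map_id0 ?div0p // divpK // dvdp_XsubCl rootE.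
by have := congr1 (fun p : {poly K} => p`_j) qa0; rewrite coef_map coef0 /= => /eqP.
Qed.

(** The lemma of Gauss. Over a closed field the primes of [K[X]] are the
    ['X - a], so being primitive means that no specialization of [f] at a point
    [a] vanishes. The linear factors of [c] are then cancelled one at a time:
    ['X - a] must divide [q], since specialization at [a] lands in a domain. *)
Lemma primitive_dvd f c g q :
    (forall a, map_poly (horner_eval a) f != 0) -> c != 0 ->
  c%:P * g = q * f -> exists q1, g = q1 * f.
Proof.
move=> prim_f; have [n] := ubnP (size c).
elim: n => // n IHn in c g q * => /ltnSE le_cn c0 cg.
have [le_c1|c_gt1] := leqP (size c) 1.
  have [a cE] : exists a, c = a%:P by exists c`_0; apply: size1_polyC.
  rewrite cE polyC_eq0 in c0; exists ((a^-1)%:P%:P * q).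
  by rewrite -mulrA -cg cE mulrA -!polyCM mulVf // mul1r.
have [a ca0] := closed_field_root closedK c_gt1.
have [c1 cE] := factor_theorem c a ca0.
have : map_poly (horner_eval a) q * map_poly (horner_eval a) f = 0.
  rewrite -rmorphM -cg rmorphM /= map_polyC /= /horner_eval.
  by rewrite (rootP ca0) mul0r.
move/eqP; rewrite mulf_eq0 (negPf (prim_f a)) orbF => /eqP/factor_inner_root[q1 qE].
have c1_0 : c1 != 0 by apply: contraNneq c0 => c1_0; rewrite cE c1_0 mul0r.
apply: (IHn c1 g q1) => //.
  by rewrite (leq_trans _ le_cn) // cE size_Mmonic ?monicXsubC // size_XsubC addn2.
have Xa0 : ('X - a%:P)%:P != 0 :> {poly {poly K}} by rewrite polyC_eq0 polyXsubC_eq0.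
by apply: (mulIf Xa0); rewrite mulrAC -polyCM -cE cg qE mulrAC.
Qed.

(** A generator is an element [f] of least degree in the outer variable and,
    among those, with a leading coefficient of least degree. The second choice
    makes [f] primitive, since a factor ['X - a] could be removed without
    leaving the prime ideal; the first makes pseudo-division by [f] exact on
    the ideal; and Gauss removes the power of the leading coefficient. *)
Lemma prime_ideal_principal (I : {poly {poly K}} -> Prop) :
    (forall f g, I f -> I g -> I (f + g)) -> (forall f g, I f -> I (g * f)) ->
    (forall f g, I (f * g) -> I f \/ I g) ->
    (forall c, I c%:P -> c = 0) -> (exists f, I f /\ f != 0) ->
  exists f, [/\ I f, f != 0 & forall g, I g -> exists q, g = q * f].
Proof.
move=> ID IM Iprime IC I0.
have [f0 [If0 f0_0] f0_min] := ex_minimizer (fun f : {poly {poly K}} => size f) I0.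
pose J f := [/\ I f, f != 0 & size f = size f0].
have J0 : exists f, J f by exists f0.
have [f [If f_0 szf] f_min] := ex_minimizer (fun f => size (lead_coef f)) J0.
exists f; split=> // g Ig.
have prim_f a : map_poly (horner_eval a) f != 0.
  apply/eqP=> /factor_inner_root[f1 fE].
  have f1_0 : f1 != 0 by apply: contraNneq f_0 => f1_0; rewrite fE f1_0 mul0r.
  have Xa0 : 'X - a%:P != 0 by rewrite polyXsubC_eq0.
  have [|If1|/IC/eqP] := Iprime f1 ('X - a%:P)%:P; first by rewrite -fE.
    have szf1 : size f1 = size f0 by rewrite -szf fE mulrC size_Cmul.
    have /f_min : J f1 by [].
    rewrite fE lead_coefM lead_coefC size_Mmonic ?lead_coef_eq0 ?monicXsubC //.
    by rewrite size_XsubC addn2 ltnn.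
  by rewrite (negPf Xa0).
have lf0 : lead_coef f ^+ scalp g f != 0 by rewrite expf_neq0 ?lead_coef_eq0.
have divE := Pdiv.Idomain.divp_eq g f.
apply: (primitive_dvd prim_f lf0); rewrite mul_polyC divE.
have [->|r0] := eqVneq (g %% f) 0; first by rewrite addr0.
have Ir : I (g %% f).
  have -> : g %% f = (lead_coef f ^+ scalp g f)%:P * g + - (g %/ f) * f.
    by rewrite mul_polyC divE mulNr addrAC subrr add0r.
  by apply: ID; apply: IM.
by have := f0_min _ (conj Ir r0); rewrite leqNgt -szf ltn_modp f_0.
Qed.

End Gauss.

(** * Square-free part of an associate of a power of a prime *)

Section PrimeElement.
Variables (R : idomainType) (p : R).
Hypothesis p0 : p != 0.
Hypothesis p_nonunit : p \isn't a GRing.unit.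
Hypothesis p_prime :
  forall x y, gen_ideal p (x * y) -> gen_ideal p x \/ gen_ideal p y.

Lemma prime_irreducible : irreducible p.
Proof.
split=> // a b pE; have [|[q aE]|[q bE]] := p_prime (x := a) (y := b).
- by exists 1; rewrite mul1r.
- have qb1 : q * b = 1 by apply: (mulIf p0); rewrite mul1r mulrAC -aE -pE.
  by right; apply/unitrP; exists q; rewrite [b * q]mulrC.
have qa1 : q * a = 1 by apply: (mulIf p0); rewrite mul1r mulrAC -bE mulrC -pE.
by left; apply/unitrP; exists q; rewrite [a * q]mulrC.
Qed.

Lemma dvd_prime_exp w h N : w * h = p ^+ N ->
  exists k, exists2 u, u \is a GRing.unit & h = u * p ^+ k.
Proof.
elim: N w h => [|N IHN] w h whE.
  exists 0%N, h; last by rewrite mulr1.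
  by apply/unitrP; exists w; rewrite [h * w]mulrC whE.
have [|[q wE]|[q hE]] := p_prime (x := w) (y := h).
- by exists (p ^+ N); rewrite whE exprSr.
- by apply: (IHN q); apply: (mulIf p0); rewrite mulrAC -wE whE exprSr.
have [|k [u u1 qE]] := IHN w q.
  by apply: (mulIf p0); rewrite -mulrA -hE whE exprSr.
by exists k.+1, u; rewrite // hE qE exprSr mulrA.
Qed.

Lemma prime_dvd_exp x k : gen_ideal p (x ^+ k.+1) -> gen_ideal p x.
Proof.
elim: k => [|k IHk]; first by rewrite expr1.
by rewrite exprS => /p_prime[|/IHk].
Qed.

Variables (h u : R) (k : nat).
Hypotheses (u_unit : u \is a GRing.unit) (hE : h = u * p ^+ k.+1).

Lemma squarefree_part_prime : squarefree_part h p.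
Proof.
exists 1%N, (fun=> p), (fun=> k); split=> [i|i j _||].
- exact: prime_irreducible.
- by rewrite !ord1.
- by rewrite big_ord1; exists u.
by rewrite big_ord1; exists 1; rewrite ?unitr1 ?mul1r.
Qed.

(** Every irreducible factor of [h] divides a power of [p], hence is associate
    to [p]; as distinct factors are not associate, there is exactly one. *)
Lemma squarefree_part_unique f : squarefree_part h f -> associate f p.
Proof.
case=> n [q [e [q_irr q_inj [a a1 hqE] [b b1 fE]]]].
have q_assoc i : associate (q i) p.
  have [q0 q_nonunit q_split] := q_irr i.
  have [w wE] : exists w, w * q i = p ^+ k.+1.
    have [r hr] : exists r, h = a * (q i ^+ (e i).+1 * r).
      by rewrite hqE (bigD1 i) //=; eexists.
    exists (u^-1 * (a * (q i ^+ e i * r))); apply: (mulrI u_unit).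
    by rewrite -hE hr !mulrA divrr // mul1r mulrAC -[X in X * r]mulrA -exprSr.
  have [[|j] [v v1 qE]] := dvd_prime_exp wE.
    by case/negP: q_nonunit; rewrite qE mulr1.
  case: (q_split (v * p ^+ j) p) => [|v'1|]; last by rewrite (negPf p_nonunit).
    by rewrite qE exprSr mulrA.
  by exists (v * p ^+ j); rewrite // qE exprSr mulrA.
have q_sym (i j : 'I_n) : i = j.
  apply: q_inj; have [v v1 vE] := q_assoc i; have [w w1 wE] := q_assoc j.
  exists (v * w^-1); first by rewrite unitrM v1 unitrV.
  by rewrite vE wE mulrA divrK.
case: n q e q_irr q_inj hqE fE q_assoc q_sym => [|[|n]] q e q_irr _ hqE fE q_assoc q_sym.
- have : h \is a GRing.unit by rewrite hqE big_ord0 mulr1.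
  by rewrite hE unitrM exprS unitrM (negPf p_nonunit) andbF.
- have [v v1 vE] := q_assoc ord0; rewrite fE big_ord1 vE.
  by exists (b * v); rewrite ?mulrA // unitrM b1.
by have := q_sym ord0 ord_max.
Qed.

End PrimeElement.

(** * Morphisms out of rings of differential operators *)

Section SkewEvaluation.
Variables (R : comNzRingType) (d : derivation R) (S : nzRingType).
Variables (phi : {rmorphism R -> S}) (t : S).
Hypothesis t_phi : forall a, t * phi a = phi a * t + phi (d a).

(** The universal property of the ring of operators: a ring morphism [phi] on
    the coefficients and an element [t] that satisfies the commutation rule of
    the derivation extend to a ring morphism. *)
Definition skew_eval (p : {poly R}) : S := (map_poly phi p).[t].

Lemma skew_eval_is_additive : additive skew_eval.
Proof. by move=> p q; rewrite /skew_eval rmorphB hornerD hornerN. Qed.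
HB.instance Definition _ :=
  GRing.isAdditive.Build {poly R} S skew_eval skew_eval_is_additive.

Lemma skew_evalZ a p : skew_eval (a *: p) = phi a * skew_eval p.
Proof. by rewrite /skew_eval map_polyZ hornerZ. Qed.

Lemma skew_eval_lmuld p : skew_eval (lmuld d p) = t * skew_eval p.
Proof.
elim/poly_ind: p => [|p c IHp]; first by rewrite lmuld0 raddf0 mulr0.
have extX q : skew_eval (q * 'X) = skew_eval q * t.
  by rewrite /skew_eval rmorphM /= map_polyX hornerMX.
have extC a : skew_eval a%:P = phi a by rewrite /skew_eval map_polyC hornerC.
have lmX : lmuld d (p * 'X) = lmuld d p * 'X.
  by rewrite /lmuld derM (pderX d) mulr0 addr0 mulrDl.
rewrite lmuldD raddfD /= lmX extX IHp.
by rewrite /lmuld (pderC d) !raddfD /= !extX !extC mulrDr t_phi mulrA.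
Qed.

Lemma skew_eval_skewmul p q : skew_eval (skewmul d p q) = skew_eval p * skew_eval q.
Proof.
have ext_iter i : skew_eval (iter i (lmuld d) q) = t ^+ i * skew_eval q.
  by elim: i => [|i IHi]; rewrite ?mul1r //= skew_eval_lmuld IHi exprS mulrA.
have -> : skew_eval p = \sum_(i < size p) phi p`_i * t ^+ i.
  rewrite /skew_eval (@horner_coef_wide _ (size p)) ?size_poly //.
  by apply: eq_bigr => i _; rewrite coef_map.
rewrite mulr_suml raddf_sum; apply: eq_bigr => i _.
by rewrite /= skew_evalZ ext_iter mulrA.
Qed.

End SkewEvaluation.

Section BaseChange.
Variables (R R' : comNzRingType) (d : derivation R) (d' : derivation R').
Variable iota : {rmorphism R -> R'}.
Hypothesis iota_der : forall a, iota (d a) = d' (iota a).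

Lemma map_poly_lmuld p :
  map_poly iota (lmuld d p) = lmuld d' (map_poly iota p).
Proof.
apply/polyP=> i; rewrite /lmuld coef_map !coefD !coefMX raddfD !coef_pder_fun !coef_map.
by rewrite -iota_der; case: eqP; rewrite ?raddf0.
Qed.

Lemma map_poly_skewmul p q : map_poly iota (skewmul d p q) =
  skewmul d' (map_poly iota p) (map_poly iota q).
Proof.
rewrite [RHS](@skewmul_wide _ _ (size p)) ?size_poly // raddf_sum.
apply: eq_bigr => i _.
rewrite /= map_polyZ coef_map; congr (_ *: _).
by elim: (nat_of_ord i) => //= j <-; rewrite map_poly_lmuld.
Qed.

End BaseChange.

Section Constants.
Variables (F : fieldType) (d : derivation F).

HB.instance Definition _ := GRing.RMorphism.copy (@cval F d) (\val : constants d -> F).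

Definition emb (a : F) : bipoly F := a%:P%:P.

Lemma emb_is_additive : additive emb.
Proof. by move=> a b; rewrite /emb !polyCB. Qed.
HB.instance Definition _ :=
  GRing.isAdditive.Build F (bipoly F) emb emb_is_additive.

Lemma emb_is_monoid_morphism : monoid_morphism emb.
Proof. by split=> // a b; rewrite /emb !polyCM. Qed.
HB.instance Definition _ :=
  GRing.isMonoidMorphism.Build F (bipoly F) emb emb_is_monoid_morphism.

Lemma const_embed_is_additive : additive (@const_embed F d).
Proof. by move=> u v; apply: raddfB. Qed.
HB.instance Definition _ := GRing.isAdditive.Build
  (bipoly (constants d)) (bipoly F) (@const_embed F d) const_embed_is_additive.

Lemma const_embed_is_monoid_morphism : monoid_morphism (@const_embed F d).
Proof.
by split=> [|u v]; [apply: rmorph1|apply: rmorphM].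
Qed.
HB.instance Definition _ := GRing.isMonoidMorphism.Build
  (bipoly (constants d)) (bipoly F) (@const_embed F d)
  const_embed_is_monoid_morphism.

Lemma bder_emb a : bder d (emb a) = emb (d a).
Proof. by rewrite /emb /bder !pderC. Qed.

Lemma der_cval (c : constants d) : d (cval c) = 0.
Proof. exact/eqP/(cvalP c). Qed.

Lemma bder_const (f : bipoly (constants d)) : bder d (const_embed f) = 0.
Proof.
apply/polyP=> j; rewrite coef_pder_fun /const_embed coef_map coef0.
apply/polyP=> i; rewrite coef_pder_fun coef_map coef0; exact: der_cval.
Qed.

Lemma const_embed_inj : injective (@const_embed F d).
Proof.
apply: map_inj_poly; rewrite ?raddf0 //.
by apply: map_inj_poly; [apply: val_inj|rewrite raddf0].
Qed.

Lemma const_embed_unit (w : bipoly (constants d)) :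
  const_embed w \is a GRing.unit -> w \is a GRing.unit.
Proof.
have cval_inj : injective (@cval F d) by apply: val_inj.
have map_cval_inj : injective (map_poly (@cval F d)).
  by apply: map_inj_poly; rewrite ?raddf0.
by rewrite !poly_unitE /const_embed !coef_map /= !size_map_inj_poly ?raddf0.
Qed.

(** The ordinary ideal generated by a constant is already differential. *)
Lemma gen_diff_ideal_const (f : bipoly (constants d)) (g : bipoly F) :
  gen_diff_ideal (bder d) (const_embed f) g <-> gen_ideal (const_embed f) g.
Proof.
split=> [gen_g|[q ->] I [_ _ IM _]]; last exact: IM.
apply: gen_g; last by exists 1; rewrite mul1r.
split=> [|_ _ [x ->] [y ->]|a _ [x ->]|_ [x ->]].
- by exists 0; rewrite mul0r.
- by exists (x + y); rewrite mulrDl.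
- by exists (a * x); rewrite mulrA.
by exists (bder d x); rewrite derM bder_const mulr0 addr0.
Qed.

End Constants.

(** * Elimination as evaluation at the commuting pair *)

Section Eval.
Variables (F : fieldType) (d : derivation F) (P Q : diffop d).
Hypothesis PQ_comm : P * Q = Q * P.

Let polyD := map_poly (map_poly (opC d)).

(** [g(P, Q)] with coefficients on the left. Evaluation of polynomials over a
    noncommutative ring puts the powers of the argument on the right, so
    iterating it gives the terms [g_ij P^i Q^j]. *)
Definition ev (g : bipoly F) : diffop d := (polyD g).[Q%:P].[P].

Lemma ev_is_additive : additive ev.
Proof. by move=> f g; rewrite /ev /polyD rmorphB !(hornerD, hornerN). Qed.
HB.instance Definition _ :=
  GRing.isAdditive.Build (bipoly F) (diffop d) ev ev_is_additive.

Lemma ev_embM a g : ev (emb a * g) = opC d a * ev g.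
Proof.
by rewrite /ev /polyD rmorphM /= /emb !(map_polyC, hornerCM) /= map_polyC hornerCM.
Qed.

Lemma evMmu g : ev (g * mu F) = ev g * Q.
Proof.
rewrite /ev /polyD rmorphM /= /mu map_polyX hornerMX hornerM_comm ?hornerC //.
by rewrite /comm_poly hornerC PQ_comm.
Qed.

Lemma ev_polyC (p : {poly F}) : ev p%:P = (map_poly (opC d) p).[P].
Proof. by rewrite /ev /polyD map_polyC hornerC. Qed.

Lemma ev_emb a : ev (emb a) = opC d a.
Proof. by rewrite /emb ev_polyC map_polyC hornerC. Qed.

Lemma evX : ev (lambda F) = P.
Proof. by rewrite ev_polyC map_polyX hornerX. Qed.

Lemma op_evalE (g : bipoly (constants d)) : op_eval g P Q = ev (const_embed g).
Proof.
rewrite /ev /polyD [_.[Q%:P]](@horner_coef_wide _ (size g)); last first.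
  by do 2!apply: leq_trans (size_poly _ _) _.
rewrite horner_sum; apply: eq_bigr => j _; rewrite -polyC_exp.
rewrite hornerM_comm ?hornerC; last first.
  by rewrite /comm_poly hornerC; apply/commrX/esym.
rewrite /const_embed !coef_map /= (@horner_coef_wide _ (size g`_j)); last first.
  by do 2!apply: leq_trans (size_poly _ _) _.
rewrite mulr_suml; apply: eq_bigr => i _.
by rewrite !coef_map.
Qed.

(** Multiplicativity needs the right factor to have constant coefficients:
    these are central, so they can be moved across the powers of [P] and
    [Q]. *)
Lemma evM_const f (g : bipoly (constants d)) :
  ev (f * const_embed g) = ev f * ev (const_embed g).
Proof.
have cC j i X : GRing.comm (polyD (const_embed g))`_j`_i X.
  by rewrite /polyD /const_embed !coef_map /=; apply/opC_comm/der_cval.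
rewrite /ev /polyD rmorphM /= -/polyD hornerM_comm; last first.
  apply: comm_coef_poly => j; apply/polyP=> i.
  by rewrite coefMC coefCM; apply: cC.
rewrite hornerM_comm //; apply: comm_coef_poly => i.
rewrite horner_coef coef_sum; apply: commr_sym; apply: commr_sum => j _.
rewrite -polyC_exp coefMC; apply: commrM; first exact/commr_sym/cC.
exact: commrX.
Qed.

Lemma ev_constM (f g : bipoly (constants d)) :
  ev (const_embed (f * g)) = ev (const_embed f) * ev (const_embed g).
Proof. by rewrite rmorphM evM_const. Qed.

End Eval.

Section Lift.
Variables (F : fieldType) (d : derivation F).
Implicit Types X Y : diffop d.

Definition liftop X : diffop (bder d) :=
  DiffOp (bder d) (map_poly (@emb F) (coefs X)).

Lemma liftop_is_additive : additive liftop.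
Proof. by move=> X Y; apply: val_inj; rewrite /= raddfB. Qed.
HB.instance Definition _ :=
  GRing.isAdditive.Build (diffop d) (diffop (bder d)) liftop liftop_is_additive.

Lemma liftop_is_monoid_morphism : monoid_morphism liftop.
Proof.
split=> [|X Y]; apply: val_inj; first by rewrite /= rmorph1.
by apply: map_poly_skewmul => a; rewrite bder_emb.
Qed.
HB.instance Definition _ := GRing.isMonoidMorphism.Build
  (diffop d) (diffop (bder d)) liftop liftop_is_monoid_morphism.

Lemma liftop_opC a : liftop (opC d a) = opC (bder d) (emb a).
Proof. by apply: val_inj; rewrite /= map_polyC. Qed.

Lemma opshiftE X c : opshift X c = liftop X - opC (bder d) c.
Proof. by []. Qed.

Variables P Q : diffop d.
Hypothesis P_order : (0 < op_order P)%N.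
Hypothesis PQ_comm : P * Q = Q * P.
Let A := opshift P (lambda F).
Let B := opshift Q (mu F).

Lemma lead_opshift c : size (coefs (opshift P c)) = (op_order P).+1 /\
  lead_coef (coefs (opshift P c)) = emb (lead_coef (coefs P)).
Proof.
have emb_inj : injective (@emb F) by move=> a b /polyC_inj/polyC_inj.
have P0 : P != 0.
  by apply: contraTneq P_order => ->; rewrite /op_order size_poly0.
have szP : size (map_poly (@emb F) (coefs P)) = (op_order P).+1.
  by rewrite size_map_inj_poly ?raddf0 // size_coefs.
have lt_c : (size (- c%:P) < size (map_poly (@emb F) (coefs P)))%N.
  by rewrite size_polyN szP (leq_ltn_trans (size_polyC_leq1 _)).
rewrite opshiftE coefsB; change (coefs (opC (bder d) c)) with c%:P.
change (coefs (liftop P)) with (map_poly (@emb F) (coefs P)).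
by rewrite size_polyDl // lead_coefDl // lead_coef_map_inj ?raddf0.
Qed.

Lemma comm_AB : A * B = B * A.
Proof.
have comm_const c (Y : diffop (bder d)) :
    bder d c = 0 -> GRing.comm Y (opC (bder d) c).
  by move=> c0; apply/commr_sym/opC_comm.
change (GRing.comm A B).
apply: commrB; last by apply: comm_const; apply: bder_mu.
apply/commr_sym/commrB; last by apply: comm_const; apply: bder_lambda.
by change (liftop Q * liftop P = liftop P * liftop Q); rewrite -!rmorphM PQ_comm.
Qed.

(** Modulo the left ideal, [X lambda] is [X P] and [X mu] is [X Q] for every
    operator [X]; the identity [x f - Z X = x (f - Z) - Z (X - x)], with [x]
    central, performs one such replacement. *)
Lemma left_ideal_ev g : in_left_ideal A B (opC (bder d) g - liftop (ev P Q g)).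
Proof.
have step (x : bipoly F) X (h f : bipoly F) : bder d x = 0 ->
    ev P Q (f * x) = ev P Q f * X ->
    (forall Z, in_left_ideal A B (Z * (liftop X - opC (bder d) x))) ->
    in_left_ideal A B (opC (bder d) f - liftop (ev P Q f)) -> h = f * x ->
  in_left_ideal A B (opC (bder d) h - liftop (ev P Q h)).
  move=> x0 evM inL fL ->; rewrite evM [liftop (_ * _)]rmorphM.
  have -> : opC (bder d) (f * x) - liftop (ev P Q f) * liftop X =
      opC (bder d) x * (opC (bder d) f - liftop (ev P Q f)) +
      - liftop (ev P Q f) * (liftop X - opC (bder d) x).
    rewrite !mulrBr !mulNr opprK -addrA mulrC rmorphM; congr (_ + _).
    by rewrite addrCA (opC_comm _ x0) addNr addr0.
  by apply: in_left_idealD; first exact: in_left_ideal_lmul.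
have add f f' : in_left_ideal A B (opC (bder d) f - liftop (ev P Q f)) ->
    in_left_ideal A B (opC (bder d) f' - liftop (ev P Q f')) ->
    in_left_ideal A B (opC (bder d) (f + f') - liftop (ev P Q (f + f'))).
  move=> fL fL'; rewrite raddfD /= [ev P Q _]raddfD /= [liftop _]raddfD /=.
  by rewrite opprD addrACA; apply: in_left_idealD.
elim/poly_ind: g => [|g p IHg]; first by rewrite !raddf0 addr0; apply: in_left_ideal0.
apply: (add).
  apply: (step (mu F) Q _ g) => //; [exact: bder_mu|exact: evMmu|].
  exact: in_left_ideal_r.
elim/poly_ind: p => [|p a IHp]; first by rewrite !raddf0 addr0; apply: in_left_ideal0.
rewrite polyCD; apply: add; last first.
  by rewrite ev_emb liftop_opC subrr; apply: in_left_ideal0.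
apply: (step (lambda F) P _ p%:P) => //; first exact: bder_lambda.
- by rewrite -polyCM !ev_polyC rmorphM /= map_polyX hornerMX.
- exact: in_left_ideal_l.
by rewrite -polyCM.
Qed.

(** It remains to see that [ev] kills the left ideal. Operators over
    [F[lambda, mu]] are polynomials in [lambda], [mu] over the operators over
    [F]; through this morphism [A] and [B] become [P - lambda] and [Q - mu],
    and left multiples of these vanish when evaluated on the right at
    [lambda = P], [mu = Q]. *)
Lemma elimination_evP g : elimination_ideal A B g <-> ev P Q g = 0.
Proof.
split=> [[C [D gE]]|g0]; last first.
  by have [C [D]] := left_ideal_ev g; rewrite g0 raddf0 subr0; exists C, D.
pose phi := map_poly (map_poly (opC d)) : {rmorphism bipoly F -> {poly {poly diffop d}}}.
pose t : {poly {poly diffop d}} := (opD d)%:P%:P.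
have t_phi (f : bipoly F) : t * phi f = phi f * t + phi (bder d f).
  apply/polyP=> j; rewrite coefD coefCM coefMC !coef_map /=.
  apply/polyP=> i; rewrite coefD coefCM coefMC !coef_map /= opD_opC.
  by rewrite !coef_pder_fun.
pose ext := skew_eval phi t.
have extM (X Y : diffop (bder d)) : ext (coefs (X * Y)) = ext (coefs X) * ext (coefs Y).
  exact: (skew_eval_skewmul t_phi).
have extD (X Y : diffop (bder d)) :
    ext (coefs (X + Y)) = ext (coefs X) + ext (coefs Y).
  exact: (raddfD (skew_eval phi t)).
have extB (X Y : diffop (bder d)) :
    ext (coefs (X - Y)) = ext (coefs X) - ext (coefs Y).
  exact: (raddfB (skew_eval phi t)).
have extC f : ext (coefs (opC (bder d) f)) = phi f.
  by rewrite /ext /skew_eval map_polyC hornerC.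
have extL X : ext (coefs (liftop X)) = X%:P%:P.
  rewrite /ext /skew_eval -map_poly_comp /= (@horner_coef_wide _ (size (coefs X))).
    rewrite [in RHS](coefs_sum X) !raddf_sum; apply: eq_bigr => i _.
    rewrite /= !polyCM -!polyC_exp coef_map_id0 /= /emb ?map_polyC //=.
      by rewrite map_polyC.
    by rewrite !raddf0.
  exact: size_poly.
have phi_lambda : phi (lambda F) = 'X%:P by rewrite /phi /= map_polyC /= map_polyX.
have phi_mu : phi (mu F) = 'X by rewrite /phi /= map_polyX.
move/(congr1 (@coefs _ _))/(congr1 ext): gE.
rewrite extC extD !extM /A /B !opshiftE !extB !extL !extC.
rewrite phi_lambda phi_mu => /(congr1 (fun p => p.[Q, P])).
rewrite -/(ev P Q g) => ->.
rewrite -polyCB hornerD [X in (X + _).[_]]hornerM_comm; last first.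
  rewrite /comm_poly hornerC mulrBl mulrBr -!polyCM PQ_comm; congr (_ - _).
  exact: commr_polyX.
rewrite [X in (_ + X).[_]]hornerM_comm; last first.
  by rewrite /comm_poly hornerD hornerN hornerC hornerX subrr mul0r mulr0.
rewrite hornerC [(_ - 'X).[_]](_ : _ = 0) ?mulr0 ?addr0; last first.
  by rewrite hornerD hornerN hornerC hornerX subrr.
rewrite mulrBr hornerD hornerN hornerMX hornerM_comm ?hornerC ?subrr //.
by rewrite /comm_poly hornerC.
Qed.

End Lift.

(** * Leading terms in the span of the commutant *)

Section Span.
Variables (F : fieldType) (d : derivation F).
Hypothesis charF : forall n, n.+1%:R != 0 :> F.
Variables P Q : diffop d.
Hypothesis P_order : (0 < op_order P)%N.
Hypothesis PQ_comm : P * Q = Q * P.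
Implicit Types (T : diffop d) (u v : bipoly (constants d)) (g : bipoly F).

(** Compare the coefficients of order one below the top in [P T = T P]: with
    [n] the order of [P] and [p], [t] the leading coefficients, everything but
    [n p t' = k t p'] cancels. *)
Lemma commutant_lead_der T k : P * T = T * P -> (size (coefs T) <= k.+1)%N ->
  (lead_coef (coefs P) * d (coefs T)`_k) *+ op_order P =
  ((coefs T)`_k * d (lead_coef (coefs P))) *+ k.
Proof.
move=> PT leT; have leP : (size (coefs P) <= (op_order P).+1)%N := leqSpred _.
have := congr1 (fun X : diffop d => (coefs X * 'X)`_(op_order P + k)) PT.
rewrite /= {2}(addnC (op_order P)) !coef_skewmulX //.
rewrite -lead_coefE -addrA [RHS]addrC mulrC => /addrI.
by rewrite addrC [(coefs T)`_k * (_ * 'X)%R`_(_)]mulrC => /addrI.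
Qed.

(** Two solutions of the equation [n p t' = k t p'] have a zero Wronskian,
    since [n p] is invertible in characteristic zero; their quotient is thus
    constant, and subtracting the right constant multiple lowers the order. *)
Lemma commutant_lead T T' k : P * T = T * P -> P * T' = T' * P ->
  (size (coefs T) <= k.+1)%N -> size (coefs T') = k.+1 ->
  exists c : constants d, (size (coefs (T + opC d (cval c) * T')%R) <= k)%N.
Proof.
move=> PT PT' leT szT'.
have := commutant_lead_der PT leT.
have := commutant_lead_der PT' (eq_leq szT').
set t := (coefs T)`_k; set t' := (coefs T')`_k => eT' eT.
set p := lead_coef _ in eT eT'.
have t'0 : t' != 0 by rewrite /t' -[k]/(k.+1.-1) -szT' lead_coef_eq0 -size_poly_eq0 szT'.
have P0 : p != 0.
  by rewrite lead_coef_eq0; apply: contraTneq P_order => P0; rewrite /op_order P0 size_poly0.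
have wr : d t * t' = t * d t'.
  have : (p * (d t * t' - t * d t')) *+ op_order P = 0.
    rewrite mulrBr mulrnBl mulrA -mulrnAl eT [p * (t * _)]mulrCA -[X in _ - X]mulrnAr eT'.
    by rewrite mulrnAl mulrnAr mulrAC mulrA subrr.
  move/eqP; rewrite -(prednK P_order) -mulr_natr !mulf_eq0 (negPf P0) (negPf (charF _)) orbF.
  by rewrite subr_eq0 => /eqP.
have dc : t / t' \in is_constant d.
  rewrite unfold_in; have : d (t / t' * t') * t' = t * d t' by rewrite divfK.
  rewrite derM mulrDl -[RHS]add0r [t / t' * _ * _]mulrAC divfK // => /addIr/eqP.
  by rewrite !mulf_eq0 (negPf t'0) !orbF.
have dNc : - (t / t') \in is_constant d by rewrite rpredN.
exists (Constant dNc); apply/leq_sizeP => j.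
rewrite leq_eqVlt raddfD /= skewmulCl coefD coefZ => /orP[/eqP<-|lt_kj].
  by rewrite -/t -/t' mulNr divfK // subrr.
by rewrite !nth_default ?szT' ?mulr0 ?addr0 // (leq_trans leT).
Qed.

Local Notation evc u := (ev P Q (const_embed u)).

Lemma evP_comm u : P * evc u = evc u * P.
Proof.
have XE : evc ('X%:P : bipoly (constants d)) = P.
  by rewrite /const_embed map_polyC /= map_polyX evX.
by have := ev_constM PQ_comm 'X%:P u; rewrite mulrC ev_constM // XE.
Qed.

(** The combinations over [F] of polynomials with constant coefficients whose
    values at [(P, Q)] have order below [k]. It tracks a presentation of [g],
    not just [ev g]: for [k = 0] it is the span of [BC(P, Q)]. *)
Inductive const_span k : bipoly F -> Prop :=
| const_span0 : const_span k 0
| const_spanS a u g : (size (coefs (evc u)) <= k)%N -> const_span k g ->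
    const_span k (emb a * const_embed u + g).

Lemma const_span_le k l g : (k <= l)%N -> const_span k g -> const_span l g.
Proof.
move=> le_kl; elim=> [|a u {}g le_uk _ IHg]; first exact: const_span0.
exact/const_spanS/IHg/(leq_trans le_uk).
Qed.

Lemma const_spanD k f g : const_span k f -> const_span k g -> const_span k (f + g).
Proof.
move=> fk gk; elim: fk => [|a u {}f le_uk _ IHf]; first by rewrite add0r.
by rewrite -addrA; apply: const_spanS.
Qed.

Lemma const_span1 k a u :
  (size (coefs (evc u)) <= k)%N -> const_span k (emb a * const_embed u).
Proof. by move=> le_uk; rewrite -[_ * _]addr0; apply/const_spanS/const_span0. Qed.

Lemma const_spanZ k a g : const_span k g -> const_span k (emb a * g).
Proof.
elim=> [|b u {}g le_uk _ IHg]; first by rewrite mulr0; apply: const_span0.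
by rewrite mulrDr mulrA -rmorphM; apply: const_spanS.
Qed.

Lemma const_spanM_const i j u g : (size (coefs (evc u)) <= i.+1)%N ->
  const_span j g -> const_span (i + j) (const_embed u * g).
Proof.
move=> le_ui; elim=> [|a v {}g le_vj _ IHg]; first by rewrite mulr0; apply: const_span0.
rewrite mulrDr mulrCA -rmorphM; apply: const_spanS => //.
by rewrite ev_constM // size_skewmul.
Qed.

Lemma const_spanM i j f g : const_span i f -> const_span j g -> const_span (i + j) (f * g).
Proof.
move=> fi gj; elim: fi => [|a u {}f le_ui _ IHf].
  by rewrite mul0r; apply: const_span0.
rewrite mulrDl -mulrA; apply: const_spanD IHf; apply/const_spanZ/const_spanM_const => //.
exact: leqW.
Qed.

Lemma size_const_span k g : const_span k g -> (size (coefs (ev P Q g)) <= k)%N.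
Proof.
elim=> [|a u {}g le_uk _ IHg]; first by rewrite raddf0 size_poly0.
rewrite raddfD /= ev_embM // (leq_trans (size_polyD _ _)) // geq_max IHg andbT.
by rewrite coefs_opCM (leq_trans (size_scale_leq _ _)).
Qed.

Lemma const_span_exists g : exists k, const_span k g.
Proof.
pose all_span f := exists k, const_span k f.
have add f f' : all_span f -> all_span f' -> all_span (f + f').
  move=> [k fk] [l f'l]; exists (maxn k l); apply: const_spanD.
    exact/(const_span_le _ fk)/leq_maxl.
  exact/(const_span_le _ f'l)/leq_maxr.
have mul u f : all_span f -> all_span (f * const_embed u).
  move=> [k fk]; exists (size (coefs (evc u)) + k)%N; rewrite mulrC.
  exact: const_spanM_const.
have zero : all_span 0 by exists 0%N; apply: const_span0.
elim/poly_ind: g => [|g p IHg] //; apply: (add).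
  have -> : 'X = const_embed ('X : bipoly (constants d)) by rewrite /const_embed map_polyX.
  exact: mul.
elim/poly_ind: p => [|p a IHp] //; rewrite polyCD; apply: (add).
  rewrite polyCM; have -> : 'X%:P = const_embed ('X%:P : bipoly (constants d)).
    by rewrite /const_embed map_polyC /= map_polyX.
  exact: mul.
exists (size (coefs (evc (1 : bipoly (constants d))))).
rewrite -[_%:P]mulr1 -(rmorph1 (@const_embed F d)).
exact: const_span1.
Qed.

(** A presentation of [g] whose top order is attained by a single term: it
    makes the order of [ev g] visible, and is stable under products. *)
Definition has_leading_term j g := exists a u g',
  [/\ a != 0, size (coefs (evc u)) = j.+1, const_span j g' &
      g = emb a * const_embed u + g'].

(** All terms of top order are proportional to the first one found, by
    [commutant_lead], up to terms of lower order; either their coefficients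
    over [F] cancel, or a leading term remains. *)
Lemma const_span_split k g : const_span k.+1 g -> const_span k g \/ has_leading_term k g.
Proof.
have lead a u g' : size (coefs (evc u)) = k.+1 -> const_span k g' ->
    const_span k (emb a * const_embed u + g') \/
    has_leading_term k (emb a * const_embed u + g').
  move=> szu g'k; have [->|a0] := eqVneq a 0; last by right; exists a, u, g'.
  by left; rewrite raddf0 mul0r add0r.
elim=> [|a u {}g le_uk _]; first by left; apply: const_span0.
case: (leqP (size (coefs (evc u))) k) => [lt_uk|ge_uk].
  case=> [gk|[b [v [g' [b0 szv g'k ->]]]]]; first by left; apply: const_spanS.
  right; exists b, v, (emb a * const_embed u + g'); split=> //.
    exact: const_spanS.
  by rewrite addrCA.
have szu : size (coefs (evc u)) = k.+1 by apply/eqP; rewrite eqn_leq le_uk.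
case=> [gk|[b [v [g' [b0 szv g'k ->]]]]]; first exact: lead.
have [c le_c] := commutant_lead (evP_comm u) (evP_comm v) le_uk szv.
have [w wE] : exists w : bipoly (constants d),
    const_embed w = const_embed u + emb (cval c) * const_embed v.
  exists (u + c%:P%:P * v).
  by rewrite rmorphD rmorphM /= /const_embed map_polyC /= map_polyC.
have eE : emb (b + a * - cval c) = emb b + emb a * emb (- cval c).
  by rewrite raddfD /= rmorphM.
have ecc : emb (- cval c) + emb (cval c) = 0 by rewrite -raddfD /= addNr raddf0.
have -> : emb a * const_embed u + (emb b * const_embed v + g') =
    emb (b + a * - cval c) * const_embed v + (emb a * const_embed w + g').
  rewrite wE eE addrA [RHS]addrA; congr (_ + _).
  rewrite mulrDr mulrDl [RHS]addrACA [LHS]addrC [RHS]addrC [in RHS]addrC.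
  by rewrite mulrA -mulrDl -mulrDr ecc mulr0 mul0r addr0 addrC.
apply: lead => //; apply: const_spanS => //.
by rewrite wE raddfD /= ev_embM.
Qed.

Lemma const_span_lead k g :
  const_span k g -> const_span 0 g \/ exists j, has_leading_term j g.
Proof.
elim: k => [|k IHk]; first by left.
by case/const_span_split=> [/IHk//|gl]; right; exists k.
Qed.

Lemma leading_term_ev_neq0 j g : has_leading_term j g -> ev P Q g != 0.
Proof.
move=> [a [u [g' [a0 szu /size_const_span sz_g' ->]]]].
rewrite raddfD /= ev_embM //; apply/eqP=> /(congr1 (fun X => (coefs X)`_j))/eqP.
rewrite /= skewmulCl coefD coefZ [(coefs _)`_j in X in _ + X]nth_default //.
by rewrite addr0 coef0 mulf_eq0 (negPf a0) -[j]/(j.+1.-1) -szu lead_coef_eq0 -size_poly_eq0 szu.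
Qed.

(** Relations over [F] between the [P^i Q^j] come from relations over the
    constants: a presentation is reduced until it is trivial or has a leading
    term, and the latter is excluded. *)
Lemma ev_eq0_const_span g : ev P Q g = 0 -> const_span 0 g.
Proof.
move=> g0; have [k /const_span_lead[//|[j /leading_term_ev_neq0]]] := const_span_exists g.
by rewrite g0 eqxx.
Qed.

(** For presentations with leading terms [a u] and [b v], the product has the
    leading term [a b u v], because [ev] is multiplicative on constant
    polynomials and operators over a field form a domain. *)
Lemma ev_prime f g : ev P Q (f * g) = 0 -> ev P Q f = 0 \/ ev P Q g = 0.
Proof.
have ev0 h : const_span 0 h -> ev P Q h = 0.
  by move/size_const_span; rewrite leqn0 size_poly_eq0 => /eqP h0; apply: val_inj.
have [k /const_span_lead[/ev0|[i [a [u [f' [a0 szu f'i ->]]]]]]] := const_span_exists f.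
  by left.
have [l /const_span_lead[/ev0|[j [b [v [g' [b0 szv g'j ->]]]]]]] := const_span_exists g.
  by right.
move=> /eqP; rewrite -[_ == _]negbK => /negP[].
apply: (@leading_term_ev_neq0 (i + j)).
exists (a * b), (u * v), (const_embed v * (emb b * f') +
  (const_embed u * (emb a * g') + f' * g')); split.
- by rewrite mulf_neq0.
- rewrite ev_constM // size_opM ?szu ?szv ?addnS //.
    by apply: contra_eq_neq szu => ->; rewrite size_poly0.
  by apply: contra_eq_neq szv => ->; rewrite size_poly0.
- apply: const_spanD.
    by rewrite addnC; apply/const_spanM_const/const_spanZ => //; rewrite szv.
  apply: const_spanD; last exact: const_spanM.
  by apply/const_spanM_const/const_spanZ => //; rewrite szu.
rewrite !rmorphM mulrDl !mulrDr mulrACA /= -addrA; congr (_ + _).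
rewrite addrCA; congr (_ + (_ + _)); last by rewrite [RHS]mulrCA mulrA.
by rewrite [LHS]mulrCA [RHS]mulrCA [f' * _]mulrC.
Qed.

End Span.

(** * The kernel of evaluation and its generator *)

Section Kernel.
Variables (F : fieldType) (d : derivation F).
Variables P Q : diffop d.
Hypothesis P_order : (0 < op_order P)%N.
Hypothesis PQ_comm : P * Q = Q * P.
Implicit Types (u v : bipoly (constants d)) (g : bipoly F).

(** The powers of [P] have distinct orders. *)
Lemma ev_lambda_eq0 (p : {poly F}) : ev P Q p%:P = 0 -> p = 0.
Proof.
elim/poly_ind: p => [|p c IHp] //.
rewrite ev_polyC rmorphD rmorphM /= map_polyX map_polyC hornerMXaddC.
rewrite -(ev_polyC P Q); have [/IHp-> |p0] := eqVneq (ev P Q p%:P) 0.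
  rewrite raddf0 !mul0r !add0r => /(congr1 (@coefs _ _)) /= /eqP.
  by rewrite polyC_eq0 => /eqP->.
have P0 : P != 0.
  by apply: contraTneq P_order => {1}->; rewrite /op_order size_poly0.
move/eqP; rewrite addr_eq0 => /eqP/(congr1 (fun X : diffop d => size (coefs X))).
rewrite (size_opM p0 P0) (size_coefs p0) (size_coefs P0) addSn addnS /= => szE.
have := size_polyC_leq1 (- c); rewrite polyCN => /(leq_trans (eq_leq szE)).
by rewrite ltnS leqn0 addn_eq0 [op_order P == _]eqn0Ngt P_order andbF.
Qed.

Lemma size_opX (X : diffop d) i :
  (size (coefs (X ^+ i)) <= (i * op_order X).+1)%N.
Proof.
elim: i => [|i IHi]; first by rewrite expr0 size_poly1.
by rewrite exprS mulSn -addnS size_skewmul ?leqSpred.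
Qed.

Lemma ev_monomial a i j :
  ev P Q ((a *: 'X^i)%:P * 'X^j) = opC d a * (P ^+ i * Q ^+ j).
Proof.
elim: j => [|j IHj].
  by rewrite !mulr1 ev_polyC map_polyZ map_polyXn hornerZ hornerXn.
by rewrite !exprSr !mulrA evMmu // IHj !mulrA.
Qed.

(** With [s] the sum of the two orders, the [(s + 1)^2] products [P^i Q^j] with
    [i, j <= s] have orders at most [s^2], so they live in a space of dimension
    [s^2 + 1]. The pair [(i, j)] is encoded by [r = i (s + 1) + j]. *)
Lemma ev_kernel_neq0 : exists g, ev P Q g = 0 /\ g != 0.
Proof.
pose s := (op_order P + op_order Q)%N; pose N := (s * s).+1.
pose T (r : nat) := P ^+ (r %/ s.+1) * Q ^+ (r %% s.+1).
have szT (r : 'I_(s.+1 * s.+1)) : (size (coefs (T r)) <= N)%N.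
  apply: leq_trans (size_skewmul _ (size_opX _ _) (size_opX _ _)) _.
  have le1 : (r %/ s.+1 <= s)%N by rewrite -ltnS ltn_divLR.
  have le2 : (r %% s.+1 <= s)%N by rewrite -ltnS ltn_mod.
  by rewrite addnS ltnS mulnDr leq_add // leq_mul.
pose M := \matrix_(r < s.+1 * s.+1, j < N) (coefs (T r))`_j.
have [v [v0 vM]] : exists v : 'rV[F]_(s.+1 * s.+1), v != 0 /\ v *m M = 0.
  have /rowV0Pn[v /sub_kermxP vM v0] : kermx M != 0; last by exists v.
  rewrite -mxrank_eq0 mxrank_ker -lt0n subn_gt0 (leq_ltn_trans (rank_leq_col _)) //.
  rewrite /N mulSn addSn ltnS mulnS addnA -[X in (X < _)%N]add0n ltn_add2r.
  by rewrite !addn_gt0 P_order.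
pose g : bipoly F := \sum_r (v 0 r *: 'X^(r %/ s.+1))%:P * 'X^(r %% s.+1).
exists g; split.
  rewrite raddf_sum; apply: val_inj; apply/polyP=> j /=.
  rewrite raddf_sum coef_sum coef0 /=.
  have [lt_jN|le_Nj] := ltnP j N.
    have := congr1 (fun A : 'rV_N => A 0 (Ordinal lt_jN)) vM.
    rewrite !mxE => vMj; rewrite -[RHS]vMj.
    by apply: eq_bigr => r _; rewrite ev_monomial coefs_opCM coefZ mxE.
  apply: big1 => r _; rewrite ev_monomial coefs_opCM coefZ.
  by rewrite nth_default ?mulr0 // (leq_trans (szT r)).
have /rV0Pn[r vr0] := v0.
apply: contraNneq vr0 => g0.
have := congr1 (fun f : bipoly F => f`_(r %% s.+1)`_(r %/ s.+1)) g0.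
rewrite !coef0 !coef_sum (bigD1 r) //= coefCM coefXn eqxx mulr1 coefZ coefXn eqxx mulr1.
rewrite big1 ?addr0 => [->//|r' r'r].
rewrite coefCM coefXn; case: eqP => [e1|_]; last by rewrite mulr0 coef0.
rewrite mulr1 coefZ coefXn; case: eqP => [e2|_]; last by rewrite mulr0.
case/eqP: r'r; apply: val_inj.
by rewrite /= (divn_eq r' s.+1) -e1 -e2 -divn_eq.
Qed.

End Kernel.

Section Main.
Variables (F : fieldType) (d : derivation F).
Hypothesis closedC : GRing.closed_field_axiom (constants d).
Hypothesis charC : [pchar (constants d)] =i pred0.
Variables P Q : diffop d.
Hypothesis P_order : (0 < op_order P)%N.
Hypothesis PQ_comm : P * Q = Q * P.

Local Notation evc u := (ev P Q (const_embed u)).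

Lemma natr_neq0 n : n.+1%:R != 0 :> F.
Proof.
have /pcharf0P nE := charC.
have := nE n.+1; rewrite -(rmorph_nat (@cval F d)) => /negbT.
by apply: contraNneq => n0; apply/eqP/val_inj.
Qed.

Lemma BC_generator : exists f0 : bipoly (constants d),
  [/\ evc f0 = 0, f0 != 0 & forall u, evc u = 0 -> gen_ideal f0 u].
Proof.
apply: (@prime_ideal_principal _ closedC (fun u => evc u = 0)).
- by move=> u v u0 v0; rewrite !raddfD /= u0 v0 addr0.
- by move=> u v u0; rewrite ev_constM // u0 mulr0.
- by move=> u v; rewrite ev_constM // => /opM_eq0.
- move=> c; rewrite /const_embed map_polyC => /(ev_lambda_eq0 P_order).
  move=> c0; apply/polyP=> i; apply: val_inj.
  by have := congr1 (fun p : {poly F} => p`_i) c0; rewrite coef_map !coef0.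
have [g [g0 gN0]] := ev_kernel_neq0 P_order PQ_comm.
have := ev_eq0_const_span natr_neq0 P_order PQ_comm g0.
move=> g_span.
suff [gE|//] : g = 0 \/ exists u : bipoly (constants d), evc u = 0 /\ u != 0.
  by rewrite gE eqxx in gN0.
elim: g_span => [|a u {g0 gN0}g sz_u _ [->|]]; [by left| |by right].
have [->|u0] := eqVneq u 0; first by left; rewrite raddf0 mulr0 addr0.
right; exists u; split=> //; apply: val_inj; apply/eqP.
by rewrite -size_poly_eq0 -leqn0.
Qed.

Lemma ev_kernel_generator : exists f0 : bipoly (constants d),
  [/\ evc f0 = 0, f0 != 0, forall u, evc u = 0 -> gen_ideal f0 u &
      forall g, ev P Q g = 0 <-> gen_ideal (const_embed f0) g].
Proof.
have [f0 [f0_ev f0_0 f0_gen]] := BC_generator.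
exists f0; split=> // g; split=> [|[q ->]]; last first.
  by rewrite evM_const // f0_ev mulr0.
move/(ev_eq0_const_span natr_neq0 P_order PQ_comm).
elim=> [|a u {}g sz_u _ [q ->]]; first by exists 0; rewrite mul0r.
have [|v ->] := f0_gen u.
  by apply: val_inj; apply/eqP; rewrite -size_poly_eq0 -leqn0.
by exists (emb a * const_embed v + q); rewrite rmorphM mulrDl mulrA.
Qed.

End Main.

Theorem theorem1p2 (Sigma : fieldType) (d : derivation Sigma)
    (closedC : GRing.closed_field_axiom (constants d))
    (charC : [pchar (constants d)] =i pred0)
    (P Q : diffop d)
    (P_nonconst : ~ has_constant_coefs P)
    (Q_nonconst : ~ has_constant_coefs Q)
    (P_order : (0 < op_order P)%N) (Q_order : (0 < op_order Q)%N)
    (PQ_comm : P * Q = Q * P) :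
  let A := opshift P (lambda Sigma) in
  let B := opshift Q (mu Sigma) in
  (exists f : bipoly (constants d), squarefree_part (dres A B) (const_embed f))
  /\ forall f : bipoly (constants d),
       squarefree_part (dres A B) (const_embed f) ->
       (forall g : bipoly (constants d), gen_ideal f g <-> BC_ideal P Q g)
       /\ (forall g : bipoly Sigma,
             gen_diff_ideal (bder d) (const_embed f) g
             <-> radical_ideal (elimination_ideal A B) g).
Proof.
move=> A B.
have [f0 [f0_ev f0_0 f0_gen evP]] :=
  ev_kernel_generator closedC charC P_order PQ_comm.
pose F0 := const_embed f0.
have F0_prime x y : gen_ideal F0 (x * y) -> gen_ideal F0 x \/ gen_ideal F0 y.
  by move/evP/(ev_prime (natr_neq0 charC) P_order PQ_comm); rewrite -!evP.
have F0_0 : F0 != 0.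
  by apply: contraNneq f0_0 => F0_0; apply/eqP/const_embed_inj; rewrite raddf0.
have F0_nonunit : F0 \isn't a GRing.unit.
  apply/negP=> F0_unit; have /evP : gen_ideal F0 1 by exists F0^-1; rewrite mulVr.
  by rewrite -(rmorph1 (@emb Sigma)) ev_emb rmorph1; apply/eqP/oner_neq0.
have [szA lcA] := lead_opshift P_order (lambda Sigma).
have A_order : (0 < op_order A)%N by rewrite /op_order szA.
have uA : lead_coef (coefs A) \is a GRing.unit.
  rewrite lcA rmorph_unit // unitfE lead_coef_eq0.
  by apply: contraTneq P_order; rewrite /op_order => ->; rewrite size_poly0.
have elimP g : elimination_ideal A B g <-> gen_ideal F0 g.
  by rewrite -evP; apply: elimination_evP.
have dres_elim : gen_ideal F0 (dres A B) by apply/elimP/dres_in_left_ideal.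
have [w wE] : exists w, w * dres A B = F0 ^+ (op_order A + op_order B).
  apply: (dres_dvd_exp A_order uA (comm_AB PQ_comm)) => X.
  (* The constant element F0 is central, so the left ideal absorbs F0 * X. *)
  have F0_elim : elimination_ideal A B F0 by apply/elimP; exists 1; rewrite mul1r.
  by rewrite (opC_comm X (bder_const f0)); apply: in_left_ideal_lmul.
have [k [u u1 hE]] := dvd_prime_exp F0_0 F0_prime wE.
case: k hE => [|k] hE.
  case: dres_elim => q; rewrite hE mulr1 => qE; case/negP: F0_nonunit.
  by move: u1; rewrite qE unitrM => /andP[].
split; first by exists f0; apply: squarefree_part_prime hE.
move=> f /(squarefree_part_unique F0_0 F0_nonunit F0_prime u1 hE)[v v1 fE].
have cfE x : gen_ideal (const_embed f) x <-> gen_ideal F0 x.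
  split=> [[q ->]|[q ->]]; first by exists (q * v); rewrite fE mulrA.
  by exists (q * v^-1); rewrite fE mulrA divrK.
have [w0 fwE] : gen_ideal f0 f by apply/f0_gen/evP; exists v.
have w0_unit : w0 \is a GRing.unit.
  apply: const_embed_unit; suff -> : const_embed w0 = v by [].
  by apply: (mulIf F0_0); rewrite -fE fwE rmorphM.
split=> g.
  rewrite /BC_ideal op_evalE //; split=> [[q ->]|/f0_gen[q ->]].
    by rewrite rmorphM evM_const // fwE ev_constM // f0_ev !mulr0.
  by exists (q / w0); rewrite fwE mulrA divrK.
rewrite gen_diff_ideal_const; split=> [/cfE gF0|[j /elimP]].
  by exists 0%N; rewrite expr1; apply/elimP.
by move/(prime_dvd_exp F0_prime)/cfE.
Qed.
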